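(* Let $\{X_n\}_{n\ge 0}$ be a $\phi$-irreducible ergodic Markov chain on a state space $\mathcal{X}$ with stationary distribution $\pi$, let $h:\mathcal{X}\to\mathbb{R}$ be measurable with $\pi(h)=\int_{\mathcal X} h\,d\pi$ finite, and let $e_n=\frac1n\sum_{i=1}^n h(X_i)$. Suppose that for some $B>0$, $$\limsup_{n\to\infty}\ n\,\mathrm{Var}(e_n)\ \le\ B^2,$$ where the variance is computed for the chain started in stationarity ($X_0\sim\pi$). Then for any $0<\alpha<1$ and $\epsilon>0$, and for $\pi$-a.e. initial state $x\in\mathcal{X}$, the intervals $$I_n:=\big(e_n-(1+\epsilon)n^{-1/2}\alpha^{-1/2}B,\ \ e_n+(1+\epsilon)n^{-1/2}\alpha^{-1/2}B\big)$$ satisfy, for the chain started at $X_0=x$, $$\liminf_{n\to\infty}P[\pi(h)\in I_n]\ \ge\ 1-\alpha.$$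
   Context: $\mathcal{X}$ is a general measurable state space and the chain is time-homogeneous with $n$-step transition kernels $P^n(x,\cdot)$. The chain is $\phi$-irreducible if there is a nonzero $\sigma$-finite measure $\phi$ on $\mathcal{X}$ such that for every measurable $A$ with $\phi(A)>0$ and every $x\in\mathcal{X}$ there is $n\in\mathbb{N}$ with $P^n(x,A)>0$. Ergodic means that $\pi$ is a stationary probability distribution and $\lim_{n\to\infty}\|P^n(x,\cdot)-\pi(\cdot)\|=0$ for $\pi$-a.e. $x\in\mathcal{X}$, where $\|\mu-\nu\|=\sup_A|\mu(A)-\nu(A)|$ is total variation distance. That $\pi(h)$ is finite means that $h$ is $\pi$-integrable. *)

(* Defs.v *)
From HB Require Import structures.
From mathcomp Require Import all_boot all_order all_algebra.
From mathcomp Require Import all_classical all_reals all_analysis.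
Set Implicit Arguments.
Unset Strict Implicit.
Unset Printing Implicit Defensive.
Import Order.TTheory GRing.Theory Num.Theory.
Import numFieldNormedType.Exports.
Local Open Scope classical_set_scope.
Local Open Scope ring_scope.

(** Setting: MathComp-Analysis, over an arbitrary [R : realType]. *)

Section kernels.
Context (d : measure_display) (S : measurableType d) (R : realType).
Implicit Types (P : R.-pker S ~> S) (pi : probability S R).

(** [P^0(x, .)] is the Dirac mass at [x], and
    [P^(n+1)(x, A) = \int P(x, dy) P^n(y, A)].  The type of subprobability
    kernels is used because it is the one for which the library proves
    closure under composition; each [nstep P n x] has total mass 1. *)
Fixpoint nstep P (n : nat) : R.-spker S ~> S :=
  match n with
  | 0%N => kdirac (@measurable_id _ S setT)
  | m.+1 => mkcomp_noparam P (nstep P m)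
  end.

(** [n] ranges over positive integers; allowing [n = 0] as well would give an
    equivalent notion. *)
Definition irreducible_wrt P (phi : set S -> \bar R) : Prop :=
  forall A, measurable A -> (0 < phi A)%E ->
    forall x, exists2 n : nat, (0 < n)%N & (0 < nstep P n x A)%E.

Definition phi_irreducible P : Prop :=
  exists phi : {sigma_finite_measure set S -> \bar R},
    phi setT <> 0%E /\ irreducible_wrt P phi.

Definition stationary P pi : Prop :=
  forall A, measurable A -> (\int[pi]_x P x A)%E = pi A.

Definition tv_dist (mu nu : set S -> \bar R) : \bar R :=
  ereal_sup [set `|mu A - nu A|%E | A in measurable].

Definition ergodic P pi : Prop :=
  stationary P pi /\
  {ae pi, forall x, tv_dist (nstep P n x) pi @[n --> \oo] --> 0%E}.

End kernels.

Section chains.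
Context (d : measure_display) (S : measurableType d) (R : realType).
Context (d' : measure_display) (T : measurableType d') (Q : probability T R).
Implicit Types (X : nat -> {RV Q >-> S}) (h : S -> R).

(** The second conjunct says that [P (X n) A] is a version of the conditional
    probability of [X n.+1 \in A] given the sigma-algebra generated by
    [X 0, ..., X n]. *)
Definition markov_chain (P : R.-pker S ~> S) (mu : set S -> \bar R) X : Prop :=
  (forall A, measurable A -> Q (X 0%N @^-1` A) = mu A) /\
  (forall (n : nat) (G : set T) (A : set S),
     g_sigma_preimage (fun i : 'I_n.+1 => (X i : T -> S)) G -> measurable A ->
     Q (G `&` X n.+1 @^-1` A) = (\int[Q]_(w in G) P (X n w) A)%E).

Definition empirical_mean h X (n : nat) (w : T) : R :=
  n%:R^-1 * \sum_(1 <= i < n.+1) h (X i w).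

End chains.

Section interval.
Context (R : realType).

Definition half_width (B alpha eps : R) (n : nat) : R :=
  (1 + eps) * (Num.sqrt n%:R)^-1 * (Num.sqrt alpha)^-1 * B.

Definition conf_interval (e B alpha eps : R) (n : nat) : interval R :=
  `](e - half_width B alpha eps n), (e + half_width B alpha eps n)[.

End interval.

(* Main.v *)
Require Import Defs.
From HB Require Import structures.
From mathcomp Require Import all_boot all_order all_algebra.
From mathcomp Require Import all_classical all_reals all_analysis.
From mathcomp Require Import measurable_realfun ring.
Set Implicit Arguments.
Unset Strict Implicit.
Unset Printing Implicit Defensive.
Import Order.TTheory GRing.Theory Num.Theory.
Import numFieldNormedType.Exports.
Local Open Scope classical_set_scope.
Local Open Scope ring_scope.

(** The argument is Chebyshev's inequality for the stationary chain, carried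
    over to the chain started at [x] by total variation.

    In stationarity [n (e_n - pi(h))] is centred, and its variance is [n] times
    [n Var(e_n)], which is eventually below [n (1 + eps')^2 B^2] for any
    [eps' > 0].  By Chebyshev, the probability that its absolute value reaches
    [(1 + eps') sqrt n B / sqrt alpha] is then at most [alpha]
    ([stationary_deviation]).

    Now start at a point [x] from which the laws converge to [pi], let
    [delta > 0], and choose a burn-in time [m] after which the law of [X_m] is
    within [delta] of [pi].  By the Markov property, the probability of any
    event about the increments of [sum_i (h(X_i) - pi(h))] after time [m] is
    the integral against the law of [X_m] of one function with values in
    [[0, 1]], the same function for every chain with kernel [P]
    ([markov_sum_expectation]).  Hence that probability differs from its
    stationary value by at most [delta] ([integral_le_discrepancy],
    [sum_probability_le_stationary]), and the stationary bound applies up to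
    [delta].

    The first [m] terms form a fixed random variable, and fixed random
    variables are tight, so for large [n] they exceed the diverging level
    [(eps / 2) sqrt n B / sqrt alpha] with probability at most [delta].  The
    slack [1 + eps] in the half-width is split as [(1 + eps / 2) + eps / 2]
    between the late and the early terms, which leaves a coverage of at least
    [1 - alpha - 2 delta] for all large [n] ([coverage_after_burn_in]). *)

(** * The Markov property for functions of the past and the next state *)

Section kernel_pullback.
Context d1 d2 d3 (W : measurableType d1) (X : measurableType d2)
  (Y : measurableType d3) (R : realType).
Variables (k : R.-pker X ~> Y) (f : W -> X).

(** Used to read [w |-> P (X n w) _] as a kernel on the sample space. *)
Definition kernel_pullback (mf : measurable_fun [set: W] f) (w : W) :
  {measure set Y -> \bar R} := k (f w).

Hypothesis mf : measurable_fun [set: W] f.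

Let measurable_kernel_pullback U : measurable U ->
  measurable_fun [set: W] (kernel_pullback mf ^~ U).
Proof. by move=> mU; exact: measurableT_comp (measurable_kernel k _ mU) mf. Qed.

HB.instance Definition _ := isKernel.Build _ _ _ _ _ (kernel_pullback mf)
  measurable_kernel_pullback.

Let kernel_pullback_prob w : kernel_pullback mf w setT = 1%E.
Proof. exact: prob_kernel. Qed.

HB.instance Definition _ := Kernel_isProbability.Build _ _ _ _ _
  (kernel_pullback mf) kernel_pullback_prob.

End kernel_pullback.

Section history.
Context (d : measure_display) (S : measurableType d) (R : realType).
Context (d' : measure_display) (T : measurableType d') (Q : probability T R).
Context (X : nat -> {RV Q >-> S}).

Definition history (n : nat) : set (set T) :=
  g_sigma_preimage (fun i : 'I_n.+1 => (X i : T -> S)).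

Lemma history_measurable n : history n `<=` measurable.
Proof.
apply: smallest_sub; first exact: sigma_algebra_measurable.
rewrite -bigcup_mkord_ord => A [i _ [B mB <-]].
exact: (measurable_funP (X (inord i : 'I_n.+1))).
Qed.

Lemma history_setT n : history n setT.
Proof.
exact: (@measurableT _ (g_sigma_algebraType (\big[setU/set0]_(i < n.+1)
  preimage_set_system setT (X i : T -> S) measurable))).
Qed.

Lemma history_sum (g : {mfun S >-> R}) (m k : nat) (A : set R) :
  measurable A ->
  history (m + k) ((fun w => \sum_(i < k) g (X (m + i).+1 w)) @^-1` A).
Proof.
move=> mA.
pose G : set (set T) := \big[setU/set0]_(i < (m + k).+1)
  preimage_set_system setT (X i : T -> S) measurable.
pose TG := g_sigma_algebraType G.
suff mV : measurable_fun (setT : set TG)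
    (fun w => \sum_(i < k) g (X (m + i).+1 w)).
  by rewrite -[_ @^-1` _]setTI; exact: mV.
apply: measurable_sum => i; apply: measurableT_comp => //.
move=> _ B mB; apply: sub_sigma_algebra.
have ik : ((m + i).+1 < (m + k).+1)%N by rewrite ltnS ltn_add2l.
rewrite /G -bigcup_mkord_ord; exists (m + i).+1 => //=.
by rewrite inordK//; exists B.
Qed.

End history.

Lemma eq_measure_rectangles d1 d2 (T1 : measurableType d1)
    (T2 : measurableType d2) (R : realType)
    (m1 m2 : {measure set (T1 * T2) -> \bar R}) :
    (m1 setT < +oo)%E ->
    (forall A B, measurable A -> measurable B -> m1 (A `*` B) = m2 (A `*` B)) ->
  forall C, measurable C -> m1 C = m2 C.
Proof.
move=> m1oo m12 C mC.
pose G : set (set (T1 * T2)) :=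
  [set A `*` B | A in measurable & B in measurable].
apply: (measure_unique G (fun=> setT)) => //.
- exact: measurable_prod_measurableType.
- move=> _ _ [A1 mA1 [B1 mB1 <-]] [A2 mA2 [B2 mB2 <-]].
  rewrite -setXI; exists (A1 `&` A2); first exact: measurableI.
  by exists (B1 `&` B2) => //; exact: measurableI.
- by move=> n; exists setT => //; exists setT => //; rewrite setXTT.
- by rewrite bigcup_const.
- by move=> _ [A mA [B mB <-]]; exact: m12.
Qed.

Section one_step.
Context (d : measure_display) (S : measurableType d) (R : realType).
Context (d' : measure_display) (T : measurableType d') (Q : probability T R).
Context (P : R.-pker S ~> S) (mu : set S -> \bar R) (X : nat -> {RV Q >-> S}).
Hypothesis chainX : markov_chain P mu X.
Context (d2 : measure_display) (U : measurableType d2).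
Local Open Scope ereal_scope.

(** The conditional law of [X n.+1] given the past is [P (X n) _], so a function
    of the pair (past statistic, next state) may be integrated over the next
    state first.  The definition of a Markov chain gives this for indicators of
    rectangles; both sides being measures on the product, it holds in
    general. *)
Lemma markov_step (n : nat) (V : T -> U) (f : U * S -> \bar R) :
    (forall A, measurable A -> history X n (V @^-1` A)) ->
    (forall u, 0 <= f u) -> measurable_fun [set: U * S] f ->
  \int[Q]_w f (V w, X n.+1 w) = \int[Q]_w \int[P (X n w)]_z f (V w, z).
Proof.
move=> hV f0 mf.
have mV : measurable_fun [set: T] V.
  by move=> _ A mA; rewrite setTI; exact: history_measurable (hV _ mA).
have mVX : measurable_fun [set: T] (fun w => (V w, X n.+1 w)).
  by apply/measurable_fun_pairP; split.
have mQ : measurable_fun [set: unit] (fun=> Q : pprobability T R).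
  exact: measurable_cst.
have mXsnd : measurable_fun [set: unit * T] (fun p => X n p.2).
  by apply: measurableT_comp => //; exact: measurable_snd.
have mpair : measurable_fun [set: (unit * T) * S] (fun p => (V p.1.2, p.2)).
  apply/measurable_fun_pairP; split => //=; last exact: measurable_snd.
  exact: (measurableT_comp mV (measurableT_comp measurable_snd measurable_fst)).
(* [m2] is the law of the pair obtained by sampling [w] from [Q], then [z] from
   [P (X n w)]; the parameter type [unit] turns [Q] into a kernel. *)
pose k := mkcomp (kernel_pullback P mXsnd) (kdirac (R := R) mpair).
pose m2 := mkcomp (kprobability mQ) k tt.
pose VX : {RV Q >-> (U * S)%type} :=
  HB.pack (fun w => (V w, X n.+1 w)) (isMeasurableFun.Build _ _ _ _ _ mVX).
have m12 C : measurable C -> distribution Q VX C = m2 C.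
  apply: eq_measure_rectangles => [|A B mA mB].
    have := probability_le1 (distribution Q VX) measurableT.
    by move=> /le_lt_trans; apply; exact: ltry.
  transitivity (Q (V @^-1` A `&` X n.+1 @^-1` B)) => //.
  rewrite (chainX.2 _ _ _ (hV _ mA) mB) integral_mkcond.
  apply: eq_integral => w _ /=.
  rewrite /k /mkcomp /= /kcomp /kernel_pullback /kdirac /= patchE.
  rewrite (eq_integral (fun z => (\1_A (V w))%:E * (\1_B z)%:E)); last first.
    by move=> z _; rewrite diracE in_setX indicE indicE -EFinM -natrM mulnb.
  rewrite ge0_integralZl//; last first.
    exact/measurable_EFinP.
  rewrite integral_indic// setIT indicE.
  have -> : (w \in V @^-1` A) = (V w \in A) by apply/idP/idP; rewrite !inE.
  by case: (V w \in A); rewrite ?mul1e ?mul0e.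
transitivity (\int[distribution Q VX]_u f u).
  by rewrite ge0_integral_distribution.
rewrite (eq_measure_integral m2)//; last by move=> C mC _; exact: m12.
rewrite /m2 integral_kcomp//; apply: eq_integral => w _.
rewrite integral_kcomp//=; apply: eq_integral => z _.
by rewrite integral_dirac// diracT mul1e.
Qed.

End one_step.

(** * Additive functionals of the chain *)

Section additive_functional.
Context (d : measure_display) (S : measurableType d) (R : realType).
Context (P : R.-pker S ~> S) (g : {mfun S >-> R}).
Implicit Types f : R * S -> \bar R.
Local Open Scope ereal_scope.

(** The Markov operator of the pair (running sum of [g], current state).  Its
    iterates describe the joint law of [sum_i g(X_i)] and the last state,
    given the state at the start of the sum. *)
Definition sum_transition f (u : R * S) : \bar R :=
  \int[P u.2]_z f ((u.1 + g z)%R, z).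

Lemma measurable_sum_transition f : (forall u, 0 <= f u) ->
  measurable_fun [set: R * S] f ->
  measurable_fun [set: R * S] (sum_transition f).
Proof.
move=> f0 mf.
have msnd : measurable_fun [set: R * S] snd by exact: measurable_snd.
apply: (measurable_fun_integral_finite_kernel
  (fun p : (R * S) * S => f ((p.1.1 + g p.2)%R, p.2))
  (kernel_pullback P msnd)) => //=.
apply: measurableT_comp => //; apply/measurable_fun_pairP; split => /=.
  apply: measurable_funD.
    exact: (measurableT_comp measurable_fst measurable_fst).
  exact: (measurableT_comp _ measurable_snd).
exact: measurable_snd.
Qed.

Lemma iter_sum_transition_ge0 k f : (forall u, 0 <= f u) ->
  forall u, 0 <= iter k sum_transition f u.
Proof. by elim: k => //= k IH f0 u; apply: integral_ge0 => z _; exact: IH. Qed.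

Lemma measurable_iter_sum_transition k f : (forall u, 0 <= f u) ->
  measurable_fun [set: R * S] f ->
  measurable_fun [set: R * S] (iter k sum_transition f).
Proof.
move=> f0 mf; elim: k => //= k IH; apply: measurable_sum_transition => //.
exact: iter_sum_transition_ge0.
Qed.

Lemma iter_sum_transition_le1 k f : (forall u, 0 <= f u) ->
  measurable_fun [set: R * S] f -> (forall u, f u <= 1) ->
  forall u, iter k sum_transition f u <= 1.
Proof.
move=> f0 mf f1; elim: k => //= k IH u.
apply: (@le_trans _ _ (\int[P u.2]_z 1)); last first.
  by rewrite integral_cst// prob_kernel mule1.
apply: ge0_le_integral => //.
- by move=> z _; exact: iter_sum_transition_ge0.
- apply: (measurableT_comp (measurable_iter_sum_transition k f0 mf)).
  apply/measurable_fun_pairP; split => /=; last exact: measurable_id.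
  exact: measurable_funD.
Qed.

(** On functions of the state alone the operator is that of the chain, and
    [nstep] iterates [P] on the same side. *)
Lemma iter_sum_transition_indic k A u : measurable A ->
  iter k sum_transition (fun p => (\1_A p.2)%:E) u = nstep P k u.2 A.
Proof.
move=> mA; elim: k u => [|k IH] u /=; first by rewrite /kdirac/= diracE indicE.
by apply: eq_integral => z _; rewrite IH.
Qed.

Context (d' : measure_display) (T : measurableType d') (Q : probability T R).
Context (mu : set S -> \bar R) (X : nat -> {RV Q >-> S}).
Hypothesis chainX : markov_chain P mu X.

(** The right-hand side depends on the chain only through the law of [X m]:
    the integrand involves nothing but [P], [g] and [f].  The last step of the
    sum is absorbed into the function by [markov_step], and one recurses on the
    shorter sum. *)
Lemma markov_sum_expectation m k f : (forall u, 0 <= f u) ->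
    measurable_fun [set: R * S] f ->
  \int[Q]_w f ((\sum_(i < k) g (X (m + i).+1 w))%R, X (m + k)%N w) =
  \int[Q]_w iter k sum_transition f (0%R, X m w).
Proof.
elim: k f => [|k IH] f f0 mf.
  by apply: eq_integral => w _; rewrite big_ord0 addn0.
rewrite iterSr -IH; last 2 first.
- by move=> u; exact: integral_ge0.
- exact: measurable_sum_transition.
rewrite addnS.
rewrite -(markov_step chainX (@history_sum _ _ _ _ _ Q X g m k)
  (f := fun p : R * S => f ((p.1 + g p.2)%R, p.2)))//; last first.
  apply: (measurableT_comp mf); apply/measurable_fun_pairP; split => /=.
    apply: measurable_funD; first exact: measurable_fst.
    exact: (measurableT_comp _ measurable_snd).
  exact: measurable_snd.
by apply: eq_integral => w _ /=; rewrite big_ord_recr.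
Qed.

End additive_functional.

(** * Comparison of a chain with the stationary one *)

(** A bound on sets passes to functions with values in [[0, 1]] without loss:
    integrate the bound for the superlevel sets [phi > r] over [0 <= r <= 1]
    (layer cake formula). *)
Lemma integral_le_discrepancy (d : measure_display) (S : measurableType d)
    (R : realType) (mu nu : probability S R) (D : R) (phi : S -> \bar R) :
    (forall A, measurable A -> mu A <= nu A + D%:E)%E ->
    measurable_fun [set: S] phi ->
    (forall x, 0 <= phi x)%E -> (forall x, phi x <= 1)%E ->
  (\int[mu]_x phi x <= \int[nu]_x phi x + D%:E)%E.
Proof.
move=> hD mphi phi0 phi1.
have phiE x : (fine (phi x))%:E = phi x.
  by rewrite fineK// ge0_fin_numE// (le_lt_trans (phi1 x)) ?ltry.
have mY : measurable_fun [set: S] (fine \o phi).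
  exact: measurableT_comp.
pose Y : {mfun S >-> R} :=
  HB.pack (fine \o phi) (isMeasurableFun.Build _ _ _ _ _ mY).
have Y0 x : 0 <= Y x by rewrite /Y/= fine_ge0.
have EE (m : probability S R) : (\int[m]_x phi x =
    \int[lebesgue_measure]_(r in `[0%R, +oo[) m (Y @^-1` `]r, +oo[))%E.
  transitivity ('E_m[Y])%E.
    by rewrite unlock; apply: eq_integral => x _; rewrite /= phiE.
  exact: (@ge0_expectation_ccdf _ _ _ m Y Y0).
have mccdf (m : probability S R) :
    measurable_fun [set: R] (fun r => m (Y @^-1` `]r, +oo[)).
  exact: (@ccdf_measurable _ _ _ m Y).
have D0 : 0 <= D.
  have := hD setT measurableT.
  rewrite (probability_setT mu) (probability_setT nu) -EFinD lee_fin.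
  by rewrite lerDl.
rewrite !EE.
apply: (@le_trans _ _ (\int[lebesgue_measure]_(r in `[0%R, +oo[)
    (nu (Y @^-1` `]r, +oo[) + D%:E * (\1_`[0, 1] r)%:E)))%E.
  apply: ge0_le_integral => //.
  - exact: measurable_funTS (mccdf _).
  - apply: emeasurable_funD; first exact: measurable_funTS (mccdf _).
    apply: emeasurable_funM => //.
    apply/measurable_EFinP; exact: measurable_indic.
  move=> r; rewrite /= in_itv/= andbT => r0.
  have [r1|r1] := leP r 1.
    rewrite indicE mem_set ?mule1; last by rewrite /= in_itv/= r0.
    by apply: hD; exact: (measurable_funPTI Y).
  rewrite (_ : Y @^-1` _ = set0) ?measure0 ?adde_ge0 ?mule_ge0//.
  apply/seteqP; split => // x /=; rewrite in_itv/= andbT.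
  move=> /(lt_trans r1); rewrite ltNge -lee_fin phiE.
  by rewrite phi1.
rewrite ge0_integralD//=; last 3 first.
- exact: measurable_funTS (mccdf _).
- by move=> r _; rewrite mule_ge0.
- apply: emeasurable_funM => //.
  apply/measurable_EFinP; exact: measurable_indic.
rewrite leeD2l// ge0_integralZl//=; last first.
  apply/measurable_EFinP; exact: measurable_indic.
rewrite integral_indic//= setIidl; last first.
  by move=> r /=; rewrite !in_itv/= andbT => /andP[].
by rewrite lebesgue_measure_itv/= lte01 sube0 mule1.
Qed.

Section laws.
Context (d : measure_display) (S : measurableType d) (R : realType).
Context (P : R.-pker S ~> S).
Local Open Scope ereal_scope.

(** Observing only the state at time [m], with the sum started at time [0] from
    the known position [x], turns [markov_sum_expectation] into the law of
    [X m]. *)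
Lemma markov_from_point_law (d' : measure_display) (T : measurableType d')
    (Q : probability T R) (x : S) (X : nat -> {RV Q >-> S}) m A :
    markov_chain P (\d_x) X -> measurable A ->
  Q (X m @^-1` A) = nstep P m x A.
Proof.
move=> chainX mA.
have mf : measurable_fun [set: R * S] (fun p => (\1_A p.2 : R)%:E).
  by apply/measurable_EFinP; apply: (measurableT_comp _ measurable_snd).
have f0 (p : R * S) : 0 <= (\1_A p.2 : R)%:E by rewrite lee_fin.
have := markov_sum_expectation (cst 0%R) chainX 0 m f0 mf.
rewrite (_ : \int[Q]_w _ = Q (X m @^-1` A)); last first.
  by rewrite -[X in Q X]setIT -integral_indic//; exact: measurable_funPTI.
move=> ->.
under eq_integral do rewrite iter_sum_transition_indic//=.
have mP := measurable_kernel (nstep P m) A mA.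
rewrite -(@ge0_integral_distribution _ _ _ _ _ _ (X 0%N)
  (fun y => nstep P m y A))//.
rewrite (eq_measure_integral (dirac x))//; last first.
  by move=> B mB _; exact: (chainX.1 B mB).
by rewrite integral_dirac// diracT mul1e.
Qed.

Lemma stationary_law (pi : probability S R) (d' : measure_display)
    (T : measurableType d') (Q : probability T R) (X : nat -> {RV Q >-> S})
    m A :
    stationary P pi -> markov_chain P pi X -> measurable A ->
  Q (X m @^-1` A) = pi A.
Proof.
move=> piP chainX; elim: m A => [|m IH] A mA; first exact: chainX.1.
have := chainX.2 m setT A (@history_setT _ _ _ _ _ _ X m) mA.
rewrite setTI => ->.
rewrite -piP//.
rewrite -(@ge0_integral_distribution _ _ _ _ _ _ (X m)
  (fun y => P y A))//; last first.
  exact: measurable_kernel.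
by apply: eq_measure_integral => B mB _; exact: IH.
Qed.

(** Both probabilities integrate one function [phi] with values in [[0, 1]],
    against the law of [X m] and against [pi] respectively. *)
Lemma sum_probability_le_stationary (g : {mfun S >-> R})
    (pi : probability S R)
    (d0 : measure_display) (T0 : measurableType d0) (Q0 : probability T0 R)
    (X0 : nat -> {RV Q0 >-> S})
    (d1 : measure_display) (T : measurableType d1) (Q : probability T R)
    (mu : set S -> \bar R) (X : nat -> {RV Q >-> S}) (m k : nat) (D : R)
    (A : set R) :
    markov_chain P pi X0 -> markov_chain P mu X ->
    (forall B, measurable B -> Q (X m @^-1` B) <= pi B + D%:E) ->
    measurable A ->
  Q [set w | A (\sum_(i < k) g (X (m + i).+1 w))%R] <=
  Q0 [set w | A (\sum_(i < k) g (X0 i.+1 w))%R] + D%:E.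
Proof.
move=> chain0 chainX hD mA.
pose f (p : R * S) : \bar R := (\1_A p.1)%:E.
have mf : measurable_fun [set: R * S] f.
  apply/measurable_EFinP.
  by apply: (measurableT_comp (measurable_indic mA) measurable_fst).
have f0 p : 0 <= f p by rewrite lee_fin.
have f1 p : f p <= 1 by rewrite lee_fin indicE; case: (_ \in _).
pose phi x := iter k (sum_transition P g) f (0%R, x).
have mphi : measurable_fun [set: S] phi.
  apply: (measurableT_comp (measurable_iter_sum_transition P g k f0 mf)).
  by apply/measurable_fun_pairP; split => /=;
    [exact: measurable_cst|exact: measurable_id].
have phi0 x : 0 <= phi x by exact: iter_sum_transition_ge0.
have phi1 x : phi x <= 1 by exact: iter_sum_transition_le1.
have probE d' (T' : measurableType d') (Q' : probability T' R)
    (mu' : set S -> \bar R) (X' : nat -> {RV Q' >-> S}) n :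
    markov_chain P mu' X' ->
    Q' [set w | A (\sum_(i < k) g (X' (n + i).+1 w))%R] =
    \int[distribution Q' (X' n)]_x phi x.
  move=> chain'; rewrite ge0_integral_distribution// /phi/=.
  rewrite -(markov_sum_expectation g chain')//.
  rewrite integral_indic ?setIT//.
  apply: (@history_measurable _ _ _ _ _ _ X' (n + k)).
  exact: history_sum.
rewrite (probE _ _ _ _ _ m chainX).
rewrite (probE _ _ _ _ X0 0%N chain0).
apply: integral_le_discrepancy => // B mB.
by rewrite [X in _ <= X + _]chain0.1//; exact: hD.
Qed.

End laws.

(** * Deviations in stationarity *)

Section centered_sums.
Context (d : measure_display) (S : measurableType d) (R : realType).
Context (h : {mfun S >-> R}) (c : R).

Let mcentered : measurable_fun [set: S] (fun y => h y - c).
Proof. exact: measurable_funB. Qed.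

Definition centered : {mfun S >-> R} :=
  HB.pack (fun y => h y - c) (isMeasurableFun.Build _ _ _ _ _ mcentered).

Context (d' : measure_display) (T : measurableType d') (Q : probability T R).
Context (X : nat -> {RV Q >-> S}).

Lemma empirical_meanB n w : (0 < n)%N ->
  empirical_mean h X n w - c = n%:R^-1 * \sum_(i < n) centered (X i.+1 w).
Proof.
move=> n0; have n0' : n%:R != 0 :> R by rewrite pnatr_eq0 -lt0n.
rewrite /empirical_mean big_add1 big_mkord /= sumrB sumr_const card_ord.
by rewrite mulrBr -[c *+ n]mulr_natl mulKf.
Qed.

Lemma measurable_sum_chain (g : {mfun S >-> R}) m k :
  measurable_fun [set: T] (fun w => \sum_(i < k) g (X (m + i).+1 w)).
Proof.
move=> _ A mA; rewrite setTI.
apply: (@history_measurable _ _ _ _ _ _ X (m + k)).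
exact: history_sum.
Qed.

Lemma measurable_empirical_mean n :
  measurable_fun [set: T] (empirical_mean h X n).
Proof.
apply: measurable_funM => //.
rewrite (_ : (fun w => _) = (fun w => \sum_(i < n) h (X (0 + i).+1 w))).
  exact: measurable_sum_chain.
by apply/funext => w; rewrite big_add1 big_mkord.
Qed.

(** Multiplying by [n] turns the half-width of order [1 / sqrt n] for the mean
    into a bound of order [sqrt n] for the centred sum. *)
Lemma mem_conf_interval (B alpha eps : R) n w : (0 < n)%N ->
  c \in conf_interval (empirical_mean h X n w) B alpha eps n =
  (`|\sum_(i < n) centered (X i.+1 w)| <
    (1 + eps) * (B / Num.sqrt alpha) * Num.sqrt n%:R).
Proof.
move=> n0; have n0' : 0 < n%:R :> R by rewrite ltr0n.
rewrite /conf_interval in_itv/= -ltr_distlC empirical_meanB//.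
rewrite normrM ger0_norm ?invr_ge0 ?ler0n// mulrC ltr_pdivrMr//.
congr (_ < _); rewrite /half_width.
rewrite -[X in _ * X = _](sqr_sqrtr (ltW n0')).
have : Num.sqrt (n%:R : R) != 0 by rewrite gt_eqF// sqrtr_gt0.
move: (Num.sqrt n%:R) (Num.sqrt alpha)^-1 => s a s0.
by field.
Qed.

End centered_sums.

Section stationary_deviation.
Context (d : measure_display) (S : measurableType d) (R : realType).
Context (P : R.-pker S ~> S) (pi : probability S R).
Context (h : {mfun S >-> R}).
Context (d' : measure_display) (T : measurableType d') (Q : probability T R).
Context (X : nat -> {RV Q >-> S}).
Hypotheses (piP : stationary P pi) (hint : pi.-integrable setT (EFin \o h)).
Hypothesis chainX : markov_chain P pi X.

Let c : R := (\int[pi]_y h y)%R.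

Lemma stationary_integrable m : Q.-integrable setT (EFin \o (h \o X m)).
Proof.
apply/integrableP; split; first exact/measurable_EFinP/measurableT_comp.
have /integrableP[_] := hint.
congr (_ < _)%E.
rewrite -(@ge0_integral_distribution _ _ _ _ _ _ (X m)
  (fun y => `|(h y)%:E|%E))//; last first.
  exact/measurableT_comp/measurable_EFinP.
apply: eq_measure_integral => A mA _.
exact: esym (stationary_law _ piP chainX mA).
Qed.

Lemma stationary_expectation m : ('E_Q[h \o X m] = c%:E)%E.
Proof.
rewrite unlock /c /Rintegral fineK; last exact: integrable_fin_num.
rewrite -[LHS](@integral_distribution _ _ _ _ _ _ (X m)
  (EFin \o h))//; last 2 first.
- exact/measurable_EFinP.
- exact: stationary_integrable.
apply: eq_measure_integral => A mA _.
exact: (stationary_law _ piP chainX mA).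
Qed.

Lemma expectation_empirical_mean n : (0 < n)%N ->
  ('E_Q[empirical_mean h X n] = c%:E)%E.
Proof.
move=> n0; rewrite unlock.
under eq_integral do rewrite /empirical_mean EFinM -sumEFin.
rewrite integralZl//; last first.
  by apply: integrable_sum => // i _; exact: stationary_integrable.
rewrite integral_sum//; last by move=> i; exact: stationary_integrable.
rewrite (eq_bigr (fun=> c%:E)); last first.
  by move=> i _; rewrite -(stationary_expectation i) unlock.
rewrite sumEFin -EFinM sumr_const_nat subSS subn0 -[c *+ n]mulr_natl mulKf//.
by rewrite pnatr_eq0 -lt0n.
Qed.

Lemma chebyshev_centered_sum k t : (0 < k)%N -> 0 < t ->
  (Q [set w | (t <= `|\sum_(i < k) centered h c (X i.+1 w)|)%R] <=
   ((k%:R / t) ^+ 2)%:E * 'V_Q[empirical_mean h X k])%E.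
Proof.
move=> k0 t0; have k0' : 0 < k%:R :> R by rewrite ltr0n.
pose e : {RV Q >-> R} := HB.pack (empirical_mean h X k)
  (isMeasurableFun.Build _ _ _ _ _ (measurable_empirical_mean h X k)).
have := @chebyshev _ _ _ Q e (t / k%:R) (divr_gt0 t0 k0').
rewrite -exprVn invf_div; congr (Q _ <= _)%E; apply/funext => w /=.
congr is_true.
rewrite expectation_empirical_mean//= (empirical_meanB _ _ _ _ k0).
by rewrite normrM ger0_norm ?invr_ge0// [X in _ <= X]mulrC ler_pM2r ?invr_gt0.
Qed.

(** The factor [1 + eps] turns the bound [B ^+ 2] on the limsup into a bound
    [((1 + eps) * B) ^+ 2] valid for every large [k].  The threshold is
    expressed with some [n >= k] because [n] will be the total number of steps
    and [k] the number left after the burn-in. *)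
Lemma stationary_deviation (B alpha eps : R) :
    (limn_esup (fun n : nat =>
       n%:R%:E * 'V_Q[empirical_mean h X n]) <= (B ^+ 2)%:E)%E ->
    0 < B -> 0 < alpha -> 0 < eps ->
  exists K : nat, forall k n : nat, (K <= k <= n)%N ->
    (Q [set w | ((1 + eps) * (B / Num.sqrt alpha) * Num.sqrt n%:R <=
      `|\sum_(i < k) centered h c (X i.+1 w)|)%R] <= alpha%:E)%E.
Proof.
move=> hvar B0 a0 e0.
pose b := (1 + eps) * B.
have b0 : 0 < b by rewrite mulr_gt0// addr_gt0.
have : (limn_esup (fun n : nat =>
       n%:R%:E * 'V_Q[empirical_mean h X n]) < (b ^+ 2)%:E)%E.
  rewrite (le_lt_trans hvar)// lte_fin ltr_pXn2r ?nnegrE ?(ltW B0) ?(ltW b0)//.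
  by rewrite /b ltr_pMl// ltrDl.
rewrite /limn_esup limf_esupE => /ereal_inf_lt[_ [V [N _ NV] <-] supV].
exists N.+1 => k n /andP[Nk kn].
have k0 : (0 < k)%N by exact: leq_trans Nk.
have kV : (k%:R%:E * 'V_Q[empirical_mean h X k] <= (b ^+ 2)%:E)%E.
  apply: le_trans (ltW supV); apply: ereal_sup_ubound.
  by exists k => //; apply: NV => /=; exact: ltnW.
have n0 : 0 < n%:R :> R by rewrite ltr0n (leq_trans k0).
set t := (1 + eps) * (B / Num.sqrt alpha) * Num.sqrt n%:R.
have tE : t ^+ 2 = b ^+ 2 / alpha * n%:R.
  rewrite /t !exprMn exprVn !sqr_sqrtr ?ler0n ?(ltW a0)//.
  by rewrite !mulrA.
have t0 : 0 < t.
  by rewrite !mulr_gt0 ?addr_gt0 ?invr_gt0 ?sqrtr_gt0.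
apply: (le_trans (chebyshev_centered_sum k0 t0)).
rewrite (_ : (k%:R / t) ^+ 2 = k%:R / t ^+ 2 * k%:R); last first.
  by rewrite expr_div_n expr2 mulrAC.
rewrite EFinM -muleA.
have kt0 : 0 <= k%:R / t ^+ 2 by rewrite divr_ge0 ?sqr_ge0.
apply: (le_trans (lee_wpmul2l _ kV)); first by rewrite lee_fin.
rewrite -EFinM lee_fin tE.
have -> : k%:R / (b ^+ 2 / alpha * n%:R) * b ^+ 2 = alpha * (k%:R / n%:R).
  by field; rewrite !gt_eqF.
by rewrite ler_piMr ?(ltW a0)// ler_pdivrMr// mul1r ler_nat.
Qed.

End stationary_deviation.

(** * Coverage after a burn-in *)

Lemma tail_abs_le (d : measure_display) (T : measurableType d) (R : realType)
    (Q : probability T R) (Y : T -> R) (delta : R) :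
    measurable_fun [set: T] Y -> 0 < delta ->
  exists2 M : R, 0 <= M & (Q [set w | (M < `|Y w|)%R] <= delta%:E)%E.
Proof.
move=> mY delta0.
have mZ : measurable_fun [set: T] (fun w => `|Y w|) by exact: measurableT_comp.
pose Z : {RV Q >-> R} := HB.pack (fun w => `|Y w|)
  (isMeasurableFun.Build _ _ _ _ _ mZ).
have [M M0 ZM] : exists2 M, M > 0 & (ccdf Z M < delta%:E)%E.
  apply: pinfty_ex_gt0; have := @cvg_ccdfy0 _ _ _ Q Z.
  by move=> /(_ _ (@nbhs_open_ereal_lt R 0 (fun=> delta) delta0)).
exists M; first exact: ltW.
rewrite (_ : [set w | _] = Z @^-1` `]M, +oo[); first exact: ltW.
by apply/seteqP; split => w; rewrite /= in_itv/= andbT.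
Qed.

Lemma le_limn_einf (R : realType) (u : (\bar R)^nat) (l : \bar R) (N : nat) :
  (forall n, (N <= n)%N -> (l <= u n)%E) -> (l <= limn_einf u)%E.
Proof.
move=> lu; rewrite /limn_einf leeNr /limn_esup limf_esupE.
apply: (@le_trans _ _ (ereal_sup [set (- u n)%E | n in [set n | (N <= n)%N]])).
  by apply: ereal_inf_lbound; exists [set n | (N <= n)%N] => //; exists N.
by apply: ge_ereal_sup => _ [n Nn <-]; rewrite leeN2; exact: lu.
Qed.

Lemma measurable_preimage_itv (d : measure_display) (T : measurableType d)
    (R : realType) (Y : T -> R) (I : interval R) :
  measurable_fun [set: T] Y -> measurable [set w | Y w \in I].
Proof.
by move=> mY; rewrite -[X in measurable X]setTI; exact: mY (measurable_itv I).
Qed.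

Section coverage.
Context (d : measure_display) (S : measurableType d) (R : realType).
Context (P : R.-pker S ~> S) (pi : probability S R).
Context (h : {mfun S >-> R}) (B alpha eps : R).
Context (d0 : measure_display) (T0 : measurableType d0) (Q0 : probability T0 R).
Context (X0 : nat -> {RV Q0 >-> S}).
Context (d1 : measure_display) (T : measurableType d1) (Q : probability T R).
Context (mu : set S -> \bar R) (X : nat -> {RV Q >-> S}).
Hypotheses (chain0 : markov_chain P pi X0) (chainX : markov_chain P mu X).
Hypotheses (B0 : 0 < B) (alpha0 : 0 < alpha) (eps0 : 0 < eps).

Let c : R := (\int[pi]_y h y)%R.
Let sd : R := B / Num.sqrt alpha.

(** An error of [delta] comes from the first [m] terms and another from
    replacing the chain after time [m] by the stationary one. *)
Lemma coverage_after_burn_in (K m : nat) (delta : R) :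
    0 < delta ->
    (forall k n : nat, (K <= k <= n)%N ->
      (Q0 [set w | ((1 + eps / 2) * sd * Num.sqrt n%:R <=
        `|\sum_(i < k) centered h c (X0 i.+1 w)|)%R] <= alpha%:E)%E) ->
    (forall A, measurable A -> (Q (X m @^-1` A) <= pi A + delta%:E)%E) ->
  exists N : nat, forall n : nat, (N <= n)%N ->
    ((1 - alpha - (delta + delta))%:E <=
     Q [set w | c \in conf_interval (empirical_mean h X n w) B alpha eps n])%E.
Proof.
move=> delta0 hK hm.
have sd0 : 0 < sd by rewrite divr_gt0// sqrtr_gt0.
pose g := centered h c.
have mU k : measurable_fun [set: T] (fun w => \sum_(i < k) g (X i.+1 w)).
  exact: (measurable_sum_chain X g 0 k).
have mW k : measurable_fun [set: T] (fun w => \sum_(i < k) g (X (m + i).+1 w)).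
  exact: measurable_sum_chain.
have [M M0 UM] := tail_abs_le Q (mU m) delta0.
pose s := eps / 2 * sd.
have s0 : 0 < s by rewrite mulr_gt0// divr_gt0.
(* [n >= (M / s) ^+ 2] makes [s * sqrt n] exceed the tightness bound [M]. *)
exists (m + maxn K (Num.truncn ((M / s) ^+ 2)).+1)%N => n Nn.
have [k nmk] : exists k, n = (m + k)%N.
  by exists (n - m)%N; rewrite subnKC// (leq_trans _ Nn)// leq_addr.
move: Nn; rewrite nmk leq_add2l geq_max => /andP[Kk Mk].
have n0 : (0 < m + k)%N.
  by rewrite (leq_trans _ (leq_addl m k))// (leq_trans _ Mk).
have Mn : M <= s * Num.sqrt (m + k)%:R.
  rewrite mulrC -ler_pdivrMr//.
  rewrite -(ler_pXn2r (n := 2))// ?nnegrE ?sqrtr_ge0 ?divr_ge0 ?(ltW s0)//.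
  rewrite sqr_sqrtr ?ler0n//.
  apply: (le_trans (ltW (truncnS_gt _))).
  by rewrite ler_nat (leq_trans Mk)// leq_addl.
pose A1 := [set w | M < `|\sum_(i < m) g (X i.+1 w)|].
pose A2 := [set w | (1 + eps / 2) * sd * Num.sqrt (m + k)%:R <=
   `|\sum_(i < k) g (X (m + i).+1 w)|].
have mA1 : measurable A1.
  rewrite (_ : A1 = [set w | `|\sum_(i < m) g (X i.+1 w)| \in `]M, +oo[]).
    by apply: measurable_preimage_itv; exact: measurableT_comp.
  by apply/seteqP; split => w; rewrite /= in_itv/= andbT.
pose E := [set y : R | `|y| \in
  `[(1 + eps / 2) * sd * Num.sqrt (m + k)%:R, +oo[].
have mE : measurable E.
  by apply: measurable_preimage_itv; exact: normr_measurable.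
have A2E : A2 = (fun w => \sum_(i < k) g (X (m + i).+1 w)) @^-1` E.
  by apply/seteqP; split => w; rewrite /A2 /E /= in_itv/= andbT.
have mA2 : measurable A2.
  by rewrite A2E -[X in measurable X]setTI; exact: mW.
have QA1 : (Q A1 <= delta%:E)%E by exact: UM.
have QA2 : (Q A2 <= alpha%:E + delta%:E)%E.
  rewrite A2E.
  apply: (le_trans (sum_probability_le_stationary g k chain0 chainX hm mE)).
  rewrite leeD2r//; have := hK k (m + k)%N.
  rewrite Kk leq_addl => /(_ isT); congr (Q0 _ <= _)%E.
  by apply/seteqP; split => w; rewrite /A2 /E /= in_itv/= andbT.
have QA12 : (Q (A1 `|` A2) <= (alpha + (delta + delta))%:E)%E.
  apply: (le_trans (measureU2 _ mA1 mA2)).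
  have -> : alpha + (delta + delta) = delta + (alpha + delta) by ring.
  by rewrite EFinD leeD.
apply: (@le_trans _ _ (Q (~` (A1 `|` A2)))).
  rewrite probability_setC; last exact: measurableU.
  have -> : 1 - alpha - (delta + delta) = 1 - (alpha + (delta + delta)).
    by ring.
  by rewrite EFinB leeD2l// leeN2.
apply: le_measure; rewrite ?inE.
- by apply: measurableC; exact: measurableU.
- rewrite (_ : [set w | _] = [set w | `|\sum_(i < m + k) g (X i.+1 w)| \in
      `]-oo, (1 + eps) * sd * Num.sqrt (m + k)%:R[]); last first.
    by apply/funext => w /=; rewrite mem_conf_interval// in_itv.
  by apply: measurable_preimage_itv; exact: measurableT_comp.
move=> w /= /not_orP[/negP]; rewrite -leNgt => w1 /negP; rewrite -ltNge => w2.
rewrite mem_conf_interval// big_split_ord/=.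
apply: (le_lt_trans (ler_normD _ _)).
have -> : (1 + eps) * sd * Num.sqrt (m + k)%:R =
  s * Num.sqrt (m + k)%:R + (1 + eps / 2) * sd * Num.sqrt (m + k)%:R.
  by rewrite /s; field.
by apply: ler_ltD => //; exact: le_trans w1 Mn.
Qed.

End coverage.

Theorem theorem1 (R : realType) (d : measure_display) (S : measurableType d)
  (P : R.-pker S ~> S) (pi : probability S R)
  (hirr : phi_irreducible P) (herg : ergodic P pi)
  (h : {mfun S >-> R}) (hint : pi.-integrable setT (EFin \o h))
  (B : R) (hB : 0 < B)
  (d0 : measure_display) (T0 : measurableType d0) (Q0 : probability T0 R)
  (X0 : nat -> {RV Q0 >-> S}) (hX0 : markov_chain P pi X0)
  (hvar : (limn_esup (fun n : nat =>
             n%:R%:E * 'V_Q0[empirical_mean h X0 n]) <= (B ^+ 2)%:E)%E)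
  (alpha eps : R) (halpha : 0 < alpha < 1) (heps : 0 < eps) :
  {ae pi, forall x : S,
    forall (d1 : measure_display) (T : measurableType d1)
           (Q : probability T R) (X : nat -> {RV Q >-> S}),
      markov_chain P (\d_x) X ->
      ((1 - alpha)%:E <=
         limn_einf (fun n : nat =>
           Q [set w | (\int[pi]_y h y)%R \in
                        conf_interval (empirical_mean h X n w) B alpha eps n]))%E}.
Proof.
have [/andP[alpha0 alpha1] [piP tv0]] := (halpha, herg).
have eps20 : 0 < eps / 2 by rewrite divr_gt0.
have [K hK] := stationary_deviation piP hint hX0 hvar hB alpha0 eps20.
apply: filterS tv0 => x tvx d1 T Q X chainX.
(* [coverage_after_burn_in] loses twice its [delta]. *)
apply/lee_subgt0Pr => e e0.
have e20 : 0 < e / 2 by rewrite divr_gt0.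
have [m _ tvm] : \forall m \near \oo,
    (tv_dist (nstep P m x) pi < (e / 2)%:E)%E.
  by have := tvx _ (@nbhs_open_ereal_lt R 0 (fun=> e / 2) e20).
have hm A : measurable A -> (Q (X m @^-1` A) <= pi A + (e / 2)%:E)%E.
  move=> mA; rewrite (markov_from_point_law m chainX mA).
  rewrite -leeBlDl ?fin_num_measure//.
  apply: (le_trans (lee_abs _)); apply: (le_trans _ (ltW (tvm m (leqnn m)))).
  by apply: ereal_sup_ubound; exists A.
have [N hN] := coverage_after_burn_in hX0 chainX hB alpha0 heps e20 hK hm.
apply: (@le_limn_einf _ _ _ N) => n Nn.
rewrite -EFinB [e]splitr; exact: hN.
Qed.
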